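(* Let $n,B_1,B_2\in\mathbb{N}$ with $n-B_1\ge B_2\ge B_1$, and let $f_j=1/j$ for $j\in[n]$. Let $h:[n]\setminus[B_1]\to[B_2]$ and $s:[n]\to\{-1,1\}$ be independent, truly (uniformly) random hash functions. For $i\in[n]\setminus[B_1]$ define $\tilde f_i=\sum_{j=B_1+1}^{n}[h(j)=h(i)]\,s(j)\,f_j$. Then for every $i\in[n]\setminus[B_1]$, $$\mathbb{E}\big[|\tilde f_i-s(i)f_i|\big]=\Theta\!\left(\frac{\log\frac{B_2+B_1}{B_1}}{B_2}\right).$$
   Context: $[m]=\{1,\dots,m\}$ and $[E]$ denotes the indicator of event $E$. This models learned Count-Sketch with one hash function: the $B_1$ heaviest items are stored exactly, the rest are sketched into $B_2$ buckets.
   Formalization: The formal theorem assumes n ≥ 3 (and B_1 ≥ 1, so that the bound is defined); this excludes only n = 2, B_1 = B_2 = 1, where the error is identically 0 while the bound equals log 2 > 0, so no positive lower constant could hold. *)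

(* Defs.v *)
From HB Require Import structures.
From mathcomp Require Import all_boot all_order all_algebra.
From mathcomp Require Import all_classical all_reals all_analysis.
Set Implicit Arguments.
Unset Strict Implicit.
Unset Printing Implicit Defensive.
Import Order.TTheory GRing.Theory Num.Theory.
Local Open Scope classical_set_scope.
Local Open Scope ring_scope.

(* Item k of {1, ..., n} is encoded as the ordinal of value k - 1 in 'I_n.
   Hence B1 <= j says that the item j + 1 is not among {1, ..., B1}. *)
Notation light n B1 := {j : 'I_n | (B1 <= j)%N}.

Definition freq (R : realType) (n : nat) (j : 'I_n) : R := (j.+1)%:R^-1.

(* The two values 1 and -1 of a random sign are encoded by false and true. *)
Definition sgn (R : realType) (b : bool) : R := (-1) ^+ b.

Definition sketch_est (R : realType) (n B1 B2 : nat)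
    (h : {ffun light n B1 -> 'I_B2}) (s : {ffun 'I_n -> bool})
    (i : light n B1) : R :=
  \sum_(j : light n B1) (h j == h i)%:R * sgn R (s (val j)) * freq R (val j).

Definition sketch_err (R : realType) (n B1 B2 : nat)
    (h : {ffun light n B1 -> 'I_B2}) (s : {ffun 'I_n -> bool})
    (i : light n B1) : R :=
  `| sketch_est R h s i - sgn R (s (val i)) * freq R (val i) |.

Section random_elements.
Context (d : measure_display) (T : measurableType d) (R : realType).
Variable P : probability T R.

(* Finite types carry the discrete sigma-algebra. *)
Definition random_element (A : finType) (X : T -> A) : Prop :=
  forall U : set A, measurable (X @^-1` U).

Definition uniformly_random (A : finType) (X : T -> A) : Prop :=
  random_element X /\
  forall a : A, P (X @^-1` [set a]) = (#|A|%:R^-1)%:E.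

Definition independent (A B : finType) (X : T -> A) (Y : T -> B) : Prop :=
  forall (U : set A) (V : set B),
    P (X @^-1` U `&` Y @^-1` V) = (P (X @^-1` U) * P (Y @^-1` V))%E.

End random_elements.

(* Main.v *)
Require Import Defs.
From HB Require Import structures.
From mathcomp Require Import all_boot all_order all_algebra.
From mathcomp Require Import all_classical all_reals all_analysis.
From mathcomp Require Import measurable_realfun ring lra zify.
Import Order.TTheory GRing.Theory Num.Theory.
Local Open Scope ring_scope.

(** The error is [|X|] with [X] the sum of [s j * f j] over the items [j <> i]
    that collide with [i], and its expectation is an average over the finitely
    many pairs [(h, s)].

    Upper bound: the items up to [B1 + B2] contribute at most the sum of
    [f j / B2], which is harmonic; the later ones contribute at most [1 / B2]
    by a second moment estimate, since the signs are orthogonal.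

    Lower bound: flipping the sign of one colliding item [j] shows that, for
    fixed [h], the average of [|X|] over the signs is at least [f j].  Hence
    [E |X|] is at least the sum, over the items [j] in a set [S], of [f j] times
    the probability that [j] is the only item of [S] that collides with [i].
    When [S] has at most [B2] items, this probability is at least
    [exp (-1) / B2]. *)

(** * Uniform averages over finite types *)

Definition avg {R : realType} {A : finType} (f : A -> R) : R :=
  (\sum_a f a) / #|A|%:R.

Section average.
Context {R : realType} {A : finType}.
Implicit Types f g : A -> R.

Lemma eq_avg f g : f =1 g -> avg f = avg g.
Proof. by move=> fg; rewrite /avg; under eq_bigr do rewrite fg. Qed.

Lemma le_avg f g : (forall a, f a <= g a) -> avg f <= avg g.
Proof. by move=> fg; rewrite ler_wpM2r ?invr_ge0// ler_sum. Qed.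

Lemma avg_cst (c : R) : (0 < #|A|)%N -> avg (fun _ : A => c) = c.
Proof.
move=> A0; rewrite /avg sumr_const -[c *+ _]mulr_natr mulfK//.
by rewrite pnatr_eq0 -lt0n.
Qed.

Lemma avgD f g : avg (fun a => f a + g a) = avg f + avg g.
Proof. by rewrite /avg big_split/= mulrDl. Qed.

Lemma avgZ (c : R) f : avg (fun a => c * f a) = c * avg f.
Proof. by rewrite /avg -mulr_sumr mulrA. Qed.

Lemma avg_sum (I : finType) (D : {pred I}) (F : I -> A -> R) :
  avg (fun a => \sum_(i in D) F i a) = \sum_(i in D) avg (F i).
Proof. by rewrite /avg exchange_big/= mulr_suml. Qed.

Lemma avg_inj (p : A -> A) f : injective p -> avg (fun a => f (p a)) = avg f.
Proof. by move=> pI; rewrite /avg [in RHS](reindex_inj pI). Qed.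

Lemma avg_pred1 (b : A) : avg (fun a => (a == b)%:R) = #|A|%:R^-1 :> R.
Proof.
by rewrite /avg (bigD1 b)//= eqxx big1 ?addr0 ?mul1r// => a /negbTE ->.
Qed.

Lemma avg_predC1 (b : A) : avg (fun a => (a != b)%:R) = 1 - #|A|%:R^-1 :> R.
Proof.
rewrite -(avg_pred1 b); apply/eqP; rewrite eq_sym subr_eq -avgD; apply/eqP.
rewrite -[LHS]avg_cst; last by apply/card_gt0P; exists b.
by apply: eq_avg => a; case: eqP; rewrite ?addr0 ?add0r.
Qed.

End average.

(** Independence of the coordinates of a uniform function: distributivity turns the product of sums
    into a sum over functions. *)
Lemma avg_ffun_prod {R : realType} {I J : finType} (F : I -> J -> R) :
  avg (fun h : {ffun I -> J} => \prod_i F i (h i)) = \prod_i avg (F i).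
Proof.
by rewrite /avg card_ffun natrX -bigA_distr_bigA big_split/= prodr_const exprVn.
Qed.

(** * From expectation to finite averages *)

Section expectation_avg.
Local Open Scope classical_set_scope.

(** The joint fibres [E p] partition [T] and all have the same probability, so the integrand is a
    finite combination of their indicators. *)
Lemma expectation_avg {d : measure_display} {T : measurableType d}
    {R : realType} {P : probability T R} {A B : finType}
    {X : T -> A} {Y : T -> B} (g : A -> B -> R) :
  uniformly_random P X -> uniformly_random P Y -> independent P X Y ->
  (forall a b, 0 <= g a b) ->
  ('E_P[fun w => g (X w) (Y w)] = (avg (fun a => avg (g a)))%:E)%E.
Proof.
move=> [mX PX] [mY PY] indep g0.
pose E (p : A * B) := X @^-1` [set p.1] `&` Y @^-1` [set p.2].
have mE p : measurable (E p) by apply: measurableI; [exact: mX|exact: mY].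
have PE p : P (E p) = (#|A|%:R^-1 * #|B|%:R^-1)%:E.
  by rewrite indep PX PY EFinM.
have split_g w : (g (X w) (Y w))%:E =
    (\sum_(p <- index_enum _) (g p.1 p.2)%:E * (\1_(E p) w)%:E)%E.
  rewrite (bigD1 (X w, Y w))//= big1 => [|[a b] /= ne].
    by rewrite adde0 indicE mem_set// mule1.
  rewrite indicE memNset ?mule0// => -[/= Xa Yb].
  by move: ne; rewrite Xa Yb eqxx.
rewrite unlock; under eq_integral do rewrite split_g.
rewrite ge0_integral_sum//; last 2 first.
- move=> p; apply: measurable_funeM; apply/measurable_EFinP.
  exact: measurable_indic.
- by move=> p w _; rewrite mule_ge0// lee_fin.
under eq_bigr => p _.
  rewrite ge0_integralZl_EFin//; last first.
    by apply/measurable_EFinP; exact: measurable_indic.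
  rewrite integral_indic// setIT [X in (_ * X)%E]PE -EFinM.
  over.
rewrite sumEFin -(pair_bigA _ (fun a b => g a b * (#|A|%:R^-1 * #|B|%:R^-1))).
congr EFin; rewrite /avg mulr_suml; apply: eq_bigr => a _.
by rewrite -mulr_suml mulrA mulrAC.
Qed.

End expectation_avg.

(** * Collision probabilities of a uniform hash function *)

Section collision.
Context {R : realType} {J K : finType}.

(* The event is split by the bucket [b] of [i]: each part is a product of
   conditions on the independent coordinates of [h]. *)
Lemma avg_isolated_collision (i j : J) (S : {set J}) :
  (0 < #|K|)%N -> j \in S -> i \notin S ->
  avg (fun h : {ffun J -> K} =>
         ((h j == h i) && [forall k in S :\ j, h k != h i])%:R)
  = #|K|%:R^-1 * (1 - #|K|%:R^-1) ^+ #|S|.-1 :> R.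
Proof.
move=> K0 jS iS.
have ji : j != i by apply: contraNneq iS => <-.
pose c b k (x : K) : bool :=
  if k \in [set i; j] then x == b else (k \in S) ==> (x != b).
transitivity (avg (fun h : {ffun J -> K} =>
    \sum_(b in K) \prod_k (c b k (h k))%:R) : R).
  apply: eq_avg => h.
  have prodE b : \prod_k (c b k (h k))%:R = [forall k, c b k (h k)]%:R :> R.
    case: forallP => [call|/forallP]; first by rewrite big1// => k _; rewrite call.
    by rewrite negb_forall => /existsP[k /negbTE ck]; rewrite (bigD1 k)//= ck mul0r.
  rewrite (bigD1 (h i))//= [X in _ + X]big1 ?addr0 => [|b bi]; last first.
    rewrite prodE; case: forallP => // /(_ i).
    by rewrite /c !inE eqxx/= eq_sym (negbTE bi).
  rewrite prodE; congr (_%:R); congr nat_of_bool.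
  apply/andP/forallP => [[hj /forall_inP hS] k|call].
    rewrite /c !inE; case: (eqVneq k i) => [->|ki]/=; first exact: eqxx.
    case: (eqVneq k j) => [->|kj] //=.
    by apply/implyP => kS; apply: hS; rewrite !inE kj.
  split; first by have := call j; rewrite /c !inE eqxx orbT.
  apply/forall_inP => k; rewrite !inE => /andP[kj kS].
  have ki : k != i by apply: contraNneq iS => <-.
  by have := call k; rewrite /c !inE (negbTE ki) (negbTE kj) kS.
rewrite avg_sum.
under eq_bigr => b _.
  rewrite (avg_ffun_prod (fun k x => (c b k x)%:R)) (bigD1 i)//= (bigD1 j)//=.
  rewrite (eq_avg _ (fun x => (x == b)%:R)); last by move=> x; rewrite /c !inE eqxx.
  rewrite (eq_avg (fun x => (c b j x)%:R) (fun x => (x == b)%:R)); last first.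
    by move=> x; rewrite /c !inE eqxx orbT.
  rewrite avg_pred1.
  rewrite (eq_bigr (fun k => if k \in S then 1 - #|K|%:R^-1 else 1)); last first.
    move=> k /andP[ki kj]; rewrite /c !inE (negbTE ki) (negbTE kj)/=.
    by case: ifP => _ /=; rewrite ?avg_predC1 ?avg_cst.
  rewrite -big_mkcondr/= (eq_bigl (mem (S :\ j))); last first.
    move=> k; rewrite !inE; case: (eqVneq k i) => [->|_] //=.
    by rewrite (negbTE iS) andbF.
  rewrite prodr_const.
  over.
(* [i] and [j] each give a factor [#|K|^-1]; summing over the [#|K|] buckets cancels one of them. *)
rewrite sumr_const (cardsD1 j S) jS/=.
rewrite -[_ *+ _]mulr_natr mulrC !mulrA mulfV ?mul1r//.
by rewrite pnatr_eq0 -lt0n.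
Qed.

(** The case [S = [set j]], where isolation is vacuous. *)
Lemma avg_collision (i j : J) : (0 < #|K|)%N -> j != i ->
  avg (fun h : {ffun J -> K} => (h j == h i)%:R) = #|K|%:R^-1 :> R.
Proof.
move=> K0 ji; have := @avg_isolated_collision i j [set j] K0 (set11 _).
rewrite cards1 expr0 mulr1 => <-; last by rewrite inE eq_sym.
apply: eq_avg => h; congr (_%:R); congr nat_of_bool.
by case: forall_inP => [|[]] => [|k]; rewrite ?andbT// !inE andNb.
Qed.

End collision.

(** * Orthogonality of random signs *)

Section signs.
Context {R : realType} {I : finType}.

Definition flip (k : I) (s : {ffun I -> bool}) : {ffun I -> bool} :=
  [ffun x => s x (+) (x == k)].

Lemma flip_inj k : injective (flip k).
Proof.
apply: (can_inj (g := flip k)) => s.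
by apply/ffunP => x; rewrite !ffunE -addbA addbb addbF.
Qed.

Lemma sgn_flip k s x :
  sgn R (flip k s x) = (if x == k then -1 else 1) * sgn R (s x).
Proof.
by rewrite ffunE /sgn signr_addb mulrC; case: (x == k); rewrite ?expr0 ?expr1.
Qed.

(** For [j != k], flipping the sign of [k] negates the product, so the average equals its own
    opposite. *)
Lemma avg_sgn_sgn (j k : I) :
  avg (fun s : {ffun I -> bool} => sgn R (s j) * sgn R (s k)) = (j == k)%:R.
Proof.
have [->|jk] := eqVneq j k.
  rewrite -[RHS](avg_cst (A := {ffun I -> bool})).
    by apply: eq_avg => s; rewrite /sgn -signr_addb addbb.
  by apply/card_gt0P; exists [ffun=> true].
rewrite [RHS](_ : _ = 0)//; set a := LHS; suff : a = - a by lra.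
rewrite /a -[LHS](avg_inj _ _ (flip_inj k)) -mulN1r -avgZ.
apply: eq_avg => s; rewrite !sgn_flip eqxx (negbTE jk); ring.
Qed.

End signs.

(** * Moments of the colliding noise *)

Section noise.
Context {R : realType} {I J K : finType} (v : J -> I) (f : J -> R) (i : J).
Hypotheses (v_inj : injective v) (f_ge0 : forall j, 0 <= f j)
  (K_gt0 : (0 < #|K|)%N).
Implicit Types (D S : {set J}) (h : {ffun J -> K}) (s : {ffun I -> bool}).

(** Hashes live on [J] and signs on the larger [I]; [v] embeds the light items into all items. *)
Definition noise D h s : R :=
  \sum_(j in D) (h j == h i)%:R * sgn R (s (v j)) * f j.

Lemma noise_l1 D : i \notin D ->
  avg (fun h => avg (fun s => `|noise D h s|))
  <= (\sum_(j in D) f j) / #|K|%:R.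
Proof.
move=> iD.
have s0 : (0 < #|{ffun I -> bool}|)%N by apply/card_gt0P; exists [ffun=> true].
apply: (@le_trans _ _
    (avg (fun h => \sum_(j in D) f j * (h j == h i)%:R))).
  apply: le_avg => h; rewrite -[leRHS](avg_cst _ s0); apply: le_avg => s.
  apply: le_trans (ler_norm_sum _ _ _) _; apply: ler_sum => j _.
  by rewrite !normrM normr_nat normr_sign mulr1 mulrC ger0_norm.
rewrite avg_sum mulr_suml; apply: ler_sum => j jD.
by rewrite avgZ avg_collision//; apply: contraNneq iD => <-.
Qed.

(** Expanding the square, orthogonality of the signs leaves only the diagonal terms. *)
Lemma noise_l2 D : i \notin D ->
  avg (fun h => avg (fun s => noise D h s ^+ 2))
  = (\sum_(j in D) f j ^+ 2) / #|K|%:R.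
Proof.
move=> iD; transitivity
    (avg (fun h => \sum_(j in D) f j ^+ 2 * (h j == h i)%:R)).
  apply: eq_avg => h; transitivity (avg (fun s => \sum_(j in D) \sum_(k in D)
      ((h j == h i)%:R * f j * ((h k == h i)%:R * f k))
      * (sgn R (s (v j)) * sgn R (s (v k))))).
    apply: eq_avg => s; rewrite expr2 /noise mulr_suml; apply: eq_bigr => j _.
    by rewrite mulr_sumr; apply: eq_bigr => k _; ring.
  rewrite avg_sum; apply: eq_bigr => j jD; rewrite avg_sum (bigD1 j)//=.
  rewrite avgZ avg_sgn_sgn eqxx big1 ?addr0 => [|k /andP[_ kj]]; last first.
    by rewrite avgZ avg_sgn_sgn (inj_eq v_inj) (eq_sym j) (negbTE kj) mulr0.
  by case: (h j == h i); rewrite /=; ring.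
rewrite avg_sum mulr_suml; apply: eq_bigr => j jD.
by rewrite avgZ avg_collision//; apply: contraNneq iD => <-.
Qed.

(** The noises at [s] and at [flip (v j) s] differ by twice the term of [j]; the triangle inequality
    bounds the sum of their absolute values from below. *)
Lemma noise_ge_term D h j : j \in D ->
  (h j == h i)%:R * f j <= avg (fun s => `|noise D h s|).
Proof.
move=> jD; set a := avg _; set c := _ * f j.
have s0 : (0 < #|{ffun I -> bool}|)%N by apply/card_gt0P; exists [ffun=> true].
suff : c *+ 2 <= a + a by lra.
rewrite {1}/a -(avg_inj _ _ (flip_inj (v j))) -avgD -[leLHS](avg_cst _ s0).
apply: le_avg => s; apply: le_trans (ler_normB _ _).
rewrite distrC /noise -sumrB (bigD1 j)//= big1 => [|k /andP[_ kj]]; last first.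
  by rewrite sgn_flip (inj_eq v_inj) (negbTE kj) mul1r subrr.
rewrite sgn_flip eqxx addr0 (_ : _ - _ = sgn R (s (v j)) * (c *+ 2)).
  by rewrite normrM normr_sign mul1r ler_norm.
by rewrite /c; ring.
Qed.

(* At most one [j] in [S] can be the only element of [S] that collides with
   [i], so the lower bounds for the single terms add up over these events. *)
Lemma noise_ge D S : S \subset D -> i \notin S -> (#|S| <= #|K|)%N ->
  (\sum_(j in S) f j) * (#|K|%:R^-1 * (1 - #|K|%:R^-1) ^+ #|K|.-1)
  <= avg (fun h => avg (fun s => `|noise D h s|)).
Proof.
move=> SD iS SK.
pose iso h j := (h j == h i) && [forall k in S :\ j, h k != h i].
apply: (@le_trans _ _ (avg (fun h => \sum_(j in S) f j * (iso h j)%:R))).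
  rewrite avg_sum mulr_suml; apply: ler_sum => j jS.
  rewrite avgZ avg_isolated_collision// ler_wpM2l// ler_wpM2l ?invr_ge0//.
  (* The base lies in [0, 1], so raising the exponent from [#|S|.-1] to [#|K|.-1] only lowers the
     power. *)
  have K1 : #|K|%:R^-1 <= 1 :> R by rewrite invf_le1 ?ler1n ?ltr0n.
  have K0 : 0 <= #|K|%:R^-1 :> R by rewrite invr_ge0.
  by apply: ler_wiXn2l; [lra | lra | lia].
apply: le_avg => h.
have [j0 /andP[j0S j0iso]|none] := pickP (fun j => (j \in S) && iso h j); last first.
  rewrite big1 => [|j jS]; last by have := none j; rewrite jS /= => ->; rewrite mulr0.
  by rewrite /avg mulr_ge0 ?invr_ge0// sumr_ge0.
rewrite (bigD1 j0)//= big1 => [|j /andP[jS jj0]]; last first.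
  rewrite /iso; case: forall_inP => [/(_ j0)|]; rewrite ?andbF ?mulr0//.
  rewrite !inE eq_sym jj0 j0S => /(_ isT).
  by move/andP: j0iso => [-> _].
rewrite addr0 mulrC; apply: le_trans (noise_ge_term _ h j0 _); last first.
  exact: (fintype.subsetP SD).
by rewrite ler_wpM2r// ler_nat; move/andP: j0iso => [-> _]; exact: leq_b1.
Qed.

End noise.

(** * Harmonic sums, logarithms and the exponential *)

Section numerics.
Context {R : realType}.

(** Both sides are [ln (1 + t) <= t], at [t = - 1 / (k + 1)] and at [t = 1 / k], with
    [1 / k <= 2 / (k + 1)]. *)
Lemma lnS_sub_bounds (k : nat) : (0 < k)%N ->
  k.+1%:R^-1 <= ln (k.+1%:R : R) - ln k%:R <= 2 * k.+1%:R^-1.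
Proof.
move=> k0; have kR : 0 < k%:R :> R by rewrite ltr0n.
have k1 : 1 <= k%:R :> R by rewrite ler1n.
have kS : k.+1%:R = k%:R + 1 :> R by rewrite -natr1.
rewrite kS; set x : R := k%:R in kR k1 *.
have x1 : 0 < (x + 1)^-1 by rewrite invr_gt0; lra.
have xV : 0 < x^-1 by rewrite invr_gt0.
have x1V : (x + 1) * (x + 1)^-1 = 1 by rewrite divff//; lra.
apply/andP; split.
  rewrite -lerN2 opprB -ln_div ?posrE//; last by lra.
  rewrite (_ : x / (x + 1) = 1 + - (x + 1)^-1); last by field; lra.
  by apply: le_ln1Dx; nra.
rewrite -ln_div ?posrE//; last by lra.
rewrite (_ : (x + 1) / x = 1 + x^-1); last by field; lra.
apply: le_trans (le_ln1Dx _) _; first lra.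
by rewrite -[x^-1]mul1r ler_pdivrMr// mulrAC ler_pdivlMr; lra.
Qed.

Lemma harmonic_ln_bounds (a b : nat) : (0 < a)%N -> (a <= b)%N ->
  \sum_(a <= k < b) k.+1%:R^-1 <= ln (b%:R : R) - ln a%:R
    <= 2 * \sum_(a <= k < b) k.+1%:R^-1.
Proof.
move=> a0 ab; rewrite -(telescope_sumr (fun k => ln k%:R))//.
by apply/andP; split; rewrite ?mulr_sumr; apply: ler_sum_nat => k /andP[ak _];
  have /andP[] := @lnS_sub_bounds k (leq_trans a0 ak).
Qed.

(** Each term is at most [1 / k - 1 / (k + 1)], which telescopes. *)
Lemma inv_square_tail (a b : nat) : (0 < a)%N -> (a <= b)%N ->
  \sum_(a <= k < b) k.+1%:R^-1 ^+ 2 <= a%:R^-1 :> R.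
Proof.
move=> a0 ab; apply: (@le_trans _ _ (- b%:R^-1 - - a%:R^-1)); last first.
  by rewrite opprK gerDr oppr_le0 invr_ge0.
rewrite -(telescope_sumr (fun k => - k%:R^-1))//.
apply: ler_sum_nat => k /andP[ak _].
have kR : 0 < k%:R :> R by rewrite ltr0n (leq_trans a0).
rewrite -natr1; set x : R := k%:R in kR *.
rewrite (_ : - _ - _ = x^-1 * (x + 1)^-1); last by field; lra.
by rewrite expr2 ler_pM2r ?invr_gt0 ?lef_pV2 ?posrE; lra.
Qed.

(** With [x = b - 1 > 0], [1 - 1 / b] is the inverse of [1 + 1 / x <= expR (1 / x)]; for [b = 1] the
    power is empty. *)
Lemma expRN1_le (b : nat) : (0 < b)%N ->
  expR (-1) <= (1 - b%:R^-1) ^+ b.-1 :> R.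
Proof.
case: b => [//|[|b]] _ /=; first by rewrite expr0 -[leRHS]expR0 ler_expR; lra.
have bR : 0 < b.+1%:R :> R by rewrite ltr0n.
rewrite -(natr1 b.+1); set x : R := b.+1%:R in bR *.
have -> : -1 = b.+1%:R * - x^-1 :> R by rewrite -/x mulrN divff ?gt_eqF.
rewrite expRM_natl ler_pXn2r// ?nnegrE ?expR_ge0//; last first.
  by rewrite subr_ge0 invf_le1; lra.
rewrite expRN (_ : 1 - _ = (1 + x^-1)^-1); last by field; lra.
have xV : 0 < x^-1 by rewrite invr_gt0.
by rewrite lef_pV2 ?expR_ge1Dx// posrE ?expR_gt0// addr_gt0.
Qed.

Lemma sum_light (n B1 a b : nat) (F : nat -> R) : (B1 <= a)%N -> (b <= n)%N ->
  \sum_(j : light n B1 | (a <= val j < b)%N) F (val j) = \sum_(a <= k < b) F k.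
Proof.
move=> Ba bn; rewrite big_geq_mkord/=.
rewrite (big_ord_widen_cond n (fun k => a <= k)%N)//.
rewrite (reindex_omap (val : light n B1 -> 'I_n) insub).
  by apply: eq_bigl => -[j Bj]/=; rewrite insubT ?Bj//= eqxx andbT.
by move=> j /andP[aj _]; rewrite insubT//; exact: leq_trans aj.
Qed.

End numerics.

(** * Bounds for the sketch error *)

Section sketch.
Context {R : realType} {n B1 B2 : nat} (i : light n B1).
Hypotheses (B1_gt0 : (0 < B1)%N) (B2_le : (B2 <= n - B1)%N)
  (B1_le : (B1 <= B2)%N).

Local Notation f := (fun j : light n B1 => freq R (val j)).
Local Notation light_noise D h s :=
  (@noise R 'I_n (light n B1) 'I_B2 val f i D h s).
(** The cut at [B1 + B2] keeps [head] within [B2] items, as the lower bound requires, and the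
    squares of the tail within [1 / B2]. *)
Local Notation head := [set j : light n B1 | (j != i) && (val j < B1 + B2)%N].
Local Notation tail := [set j : light n B1 | (j != i) && ~~ (val j < B1 + B2)%N].
Local Notation H := (\sum_(B1 <= k < B1 + B2) k.+1%:R^-1 : R).

Let f_ge0 (j : light n B1) : 0 <= f j.
Proof. by rewrite /freq invr_ge0. Qed.

Let card_gt0 : (0 < #|'I_B2|)%N.
Proof. by rewrite card_ord; lia. Qed.

(** Item [i] collides with itself, so its term cancels the true signed frequency. *)
Lemma sketch_errE h s : sketch_err R h s i = `|light_noise [set~ i] h s|.
Proof.
rewrite /sketch_err /sketch_est (bigD1 i)//= eqxx mul1r addrC addrK.
by congr `|_|; apply: eq_bigl => j; rewrite !inE.
Qed.

Lemma sum_head_le : \sum_(j in head) f j <= H.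
Proof.
rewrite -(@sum_light _ n B1 B1 (B1 + B2) (fun k => k.+1%:R^-1)); [|lia|lia].
rewrite [leLHS]big_mkcond [leRHS]big_mkcond/=; apply: ler_sum => j _.
rewrite inE (valP j)/=; case: (j != i) => //=.
by case: ifP => // _; exact: f_ge0.
Qed.

(** Leaving out [i] costs at most the largest light frequency. *)
Lemma sum_head_ge : H - B1.+1%:R^-1 <= \sum_(j in head) f j.
Proof.
rewrite -(@sum_light _ n B1 B1 (B1 + B2) (fun k => k.+1%:R^-1)); [|lia|lia].
rewrite lerBlDr.
have [iH|iH] := boolP (val i < B1 + B2)%N.
  rewrite (bigD1 i)/= ?(valP i)// addrC; apply: lerD.
    rewrite (eq_bigl (fun j => j \in head)) => [|j]; first exact: lexx.
    by rewrite inE (valP j) andbC.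
  by rewrite lef_pV2 ?posrE ?ltr0n// ler_nat ltnS (valP i).
rewrite -[leLHS]addr0; apply: lerD; last by rewrite invr_ge0.
rewrite (eq_bigl (fun j => j \in head)) => [|j]; first exact: lexx.
rewrite inE (valP j)/=.
by case: eqVneq => [->|//]; rewrite (negbTE iH).
Qed.

Lemma card_head : (#|head| <= B2)%N.
Proof.
rewrite -(ler_nat R) -sum1_card natr_sum.
rewrite (_ : B2%:R = \sum_(B1 <= k < B1 + B2) 1 :> R); last first.
  by rewrite big_const_nat iter_addr_0 addKn.
rewrite -(@sum_light _ n B1 B1 (B1 + B2) (fun=> 1)); [|lia|lia].
rewrite [leLHS]big_mkcond [leRHS]big_mkcond/=; apply: ler_sum => j _.
by rewrite inE (valP j)/=; case: (j != i) => //=; case: ifP.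
Qed.

Lemma sum_tail_le : \sum_(j in tail) f j ^+ 2 <= B2%:R^-1.
Proof.
apply: (@le_trans _ _ (B1 + B2)%:R^-1); last first.
  by rewrite lef_pV2 ?posrE ?ltr0n ?ler_nat; lia.
apply: le_trans (@inv_square_tail R (B1 + B2) n _ _); [|lia|lia].
rewrite -(@sum_light _ n B1 _ n (fun k => k.+1%:R^-1 ^+ 2)); [|lia|lia].
rewrite [leLHS]big_mkcond [leRHS]big_mkcond/=; apply: ler_sum => j _.
rewrite inE -leqNgt ltn_ord andbT; case: (j != i) => //=.
by case: ifP => // _; rewrite exprn_ge0.
Qed.

Lemma avg_sketch_err_le :
  avg (fun h : {ffun light n B1 -> 'I_B2} => avg (fun s => sketch_err R h s i))
  <= (H + 1) / B2%:R.
Proof.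
have B2R : 0 < B2%:R :> R by rewrite ltr0n; lia.
have s0 : (0 < #|{ffun 'I_n -> bool}|)%N by apply/card_gt0P; exists [ffun=> true].
have h0 : (0 < #|{ffun light n B1 -> 'I_B2}|)%N.
  by rewrite card_ffun expn_gt0 card_gt0.
have iN (D : pred (light n B1)) : i \notin [set j | (j != i) && D j].
  by rewrite inE eqxx.
(* AM-GM: [2 |y| <= B2 y^2 + 1 / B2] *)
have amgm (y : R) : `|y| <= B2%:R / 2 * y ^+ 2 + (2 * B2%:R)^-1.
  rewrite -real_normK ?num_real// -subr_ge0.
  rewrite (_ : _ - _ = B2%:R / 2 * (`|y| - B2%:R^-1) ^+ 2); last by field; lra.
  by rewrite mulr_ge0 ?divr_ge0 ?sqr_ge0// ltW.
apply: (@le_trans _ _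
    (avg (fun h => avg (fun s => `|light_noise head h s|)) +
     (B2%:R / 2 * avg (fun h => avg (fun s => light_noise tail h s ^+ 2))
      + (2 * B2%:R)^-1))).
  rewrite -(avg_cst (2 * B2%:R)^-1 h0) -avgZ -!avgD; apply: le_avg => h.
  rewrite -(avg_cst (2 * B2%:R)^-1 s0) -avgZ -!avgD; apply: le_avg => s.
  rewrite sketch_errE (_ : light_noise _ h s = light_noise head h s + light_noise tail h s).
    by apply: le_trans (ler_normD _ _) _; rewrite lerD2l amgm.
  rewrite /noise (bigID (fun j : light n B1 => val j < B1 + B2)%N)/=.
  by congr (_ + _); apply: eq_bigl => j; rewrite !inE.
rewrite noise_l2; [|exact: val_inj|exact: card_gt0|exact: iN (fun j => ~~ (val j < B1 + B2)%N)].
have := @noise_l1 R 'I_n _ 'I_B2 val f i f_ge0 card_gt0 head (iN _).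
have := sum_head_le; have := sum_tail_le.
rewrite card_ord; set t := \sum_(_ in _) _; set u := \sum_(_ in _) _.
move=> tB uH A1; rewrite [leRHS]mulrDl; apply: lerD.
  by apply: le_trans A1 _; rewrite ler_pM2r ?invr_gt0.
(* The tail gives [t / 2 <= 1 / (2 * B2)], which with the AM-GM constant makes up the [1] in
   [H + 1]. *)
rewrite (_ : _ * (t / _) = t / 2); last by field; lra.
by rewrite invfM; lra.
Qed.

Lemma avg_sketch_err_ge (S : {set light n B1}) :
  i \notin S -> (#|S| <= B2)%N ->
  (\sum_(j in S) f j) * (expR (-1) / B2%:R)
  <= avg (fun h : {ffun light n B1 -> 'I_B2} =>
            avg (fun s => sketch_err R h s i)).
Proof.
move=> iS SB.
under eq_avg => h do under eq_avg => s do rewrite sketch_errE.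
have SD : S \subset [set~ i].
  by apply/fintype.subsetP => j jS; rewrite !inE; apply: contraNneq iS => <-.
have := @noise_ge R 'I_n _ 'I_B2 val f i val_inj f_ge0 card_gt0 _ _ SD iS.
rewrite card_ord => /(_ SB); apply: le_trans.
rewrite ler_wpM2l ?sumr_ge0// mulrC ler_wpM2l ?invr_ge0//.
by apply: expRN1_le; lia.
Qed.

(** [head] serves once [B2 > 1]. For [B1 = B2 = 1] it is empty when [i] is its only candidate, so a
    singleton is taken instead. *)
Lemma light_set_ge : (2 < n)%N ->
  exists S : {set light n B1}, [/\ i \notin S, (#|S| <= B2)%N &
    (ln (B1 + B2)%:R - ln B1%:R) / 6 <= \sum_(j in S) f j].
Proof.
move=> n2; have [B2_1|B2_gt1] := leqP B2 1.
  have B11 : B1 = 1%N by lia.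
  have B21 : B2 = 1%N by lia.
  (* The items of values 1 and 2 are both light; one of them differs from [i]. *)
  have [j ji jle] : exists2 j : light n B1, j != i & (val j <= 2)%N.
    have lt1 : (1 < n)%N by lia.
    have le1 : (B1 <= Ordinal lt1)%N by rewrite B11.
    have le2 : (B1 <= Ordinal n2)%N by rewrite B11.
    have [i1|] := eqVneq (Sub (Ordinal lt1) le1 : light n B1) i.
      by exists (Sub (Ordinal n2) le2) => //; rewrite -i1.
    by exists (Sub (Ordinal lt1) le1).
  exists [set j]; rewrite inE eq_sym ji cards1 B21 big_set1; split=> //.
  apply: (@le_trans _ _ 3%:R^-1).
    rewrite B11 ln1 subr0.
    have : ln (1 + 1)%:R <= 1 :> R by rewrite natrD; apply: le_ln1Dx; lra.
    by lra.
  by rewrite /freq lef_pV2 ?posrE ?ltr0n// ler_nat ltnS.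
exists head; split; [by rewrite inE eqxx | exact: card_head |].
(* With [a <= 2 * b] and [a + b <= u], removing [a] leaves [w >= u / 3]; since [l <= 2 * u], this
   gives the constant 6. *)
have := sum_head_ge.
have /andP[_] := @harmonic_ln_bounds R B1 (B1 + B2) B1_gt0 (leq_addr _ _).
have : B1.+1%:R^-1 + B1.+2%:R^-1 <= H.
  rewrite big_ltn; last by lia.
  rewrite big_ltn; last by lia.
  by rewrite addrA lerDl sumr_ge0// => k _; rewrite invr_ge0.
have : B1.+1%:R^-1 <= 2 * B1.+2%:R^-1 :> R.
  rewrite -[leRHS]mulrC ler_pdivlMl ?ltr0n// ler_pdivrMr ?ltr0n//.
  by rewrite -natrM ler_nat; lia.
have : 0 <= B1.+1%:R^-1 :> R by rewrite invr_ge0.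
set a := B1.+1%:R^-1; set b := B1.+2%:R^-1; set u := H; set l := ln _ - _.
by set w := \sum_(j in _) _; move: a b u l w => a b u l w; lra.
Qed.

End sketch.

Theorem theorem5p1 (R : realType) :
  exists c C : R, [/\ 0 < c, 0 < C &
    forall n B1 B2 : nat,
      (0 < B1)%N -> (B2 <= n - B1)%N -> (B1 <= B2)%N ->
      (* the only excluded case is n = 2, B1 = B2 = 1, where the error is 0 *)
      (2 < n)%N ->
    forall (d : measure_display) (T : measurableType d) (P : probability T R)
      (h : T -> {ffun light n B1 -> 'I_B2}) (s : T -> {ffun 'I_n -> bool}),
      uniformly_random P h -> uniformly_random P s -> independent P h s ->
    forall i : light n B1,
      let bound := ln ((B2%:R + B1%:R) / B1%:R) / B2%:R in
      ((c * bound)%:E <= 'E_P[fun w => sketch_err R (h w) (s w) i]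
         <= (C * bound)%:E)%E].
Proof.
(* [expR (-1)] comes from isolation and 6 from [light_set_ge]; 3 comes from adding [1 <= 2 * l] to
   [H <= l], where [l] is the logarithm. *)
exists (expR (-1) / 6), 3; split; [by rewrite divr_gt0 ?expR_gt0 | by [] |].
move=> n B1 B2 B1_gt0 B2_le B1_le n2 d T P h s uh us hs i; cbv zeta.
have B1R : 0 < B1%:R :> R by rewrite ltr0n.
have B2R : 0 < B2%:R :> R by rewrite ltr0n; lia.
rewrite ln_div ?posrE ?addr_gt0// (addrC B2%:R) -natrD.
rewrite (expectation_avg (fun h s => sketch_err R h s i) uh us hs); last first.
  by move=> a b; exact: normr_ge0.
rewrite !lee_fin; apply/andP; split.
  have [S [iS SB lnS]] := @light_set_ge R n B1 B2 i B1_gt0 B2_le B1_le n2.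
  apply: le_trans (avg_sketch_err_ge i B1_gt0 B2_le B1_le S iS SB).
  rewrite (_ : _ * _ = (ln (B1 + B2)%:R - ln B1%:R) / 6 * (expR (-1) / B2%:R)).
    by rewrite ler_wpM2r// divr_ge0 ?expR_ge0.
  by ring.
apply: le_trans (avg_sketch_err_le i B1_gt0 B2_le B1_le) _.
rewrite mulrA ler_pM2r ?invr_gt0//.
have /andP[Hle _] := @harmonic_ln_bounds R B1 (B1 + B2) B1_gt0 (leq_addr _ _).
(* [2 B1 <= B1 + B2] and [1 / 2 <= ln 2] absorb the contribution of the tail. *)
have : 2^-1 <= ln (B1 + B2)%:R - ln B1%:R :> R.
  have /andP[ln2 _] := @lnS_sub_bounds R 1 isT.
  move: ln2; rewrite ln1 subr0 => /le_trans; apply.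
  rewrite -ln_div ?posrE ?ltr0n ?addn_gt0 ?B1_gt0// ler_ln ?posrE ?ltr0n//.
    by rewrite ler_pdivlMr// -natrM ler_nat; lia.
  by rewrite divr_gt0// ltr0n; lia.
by lra.
Qed.
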